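(* Let $L$ be a compact topological orthoalgebra in which $0$ is an isolated point. Then: (a) there is a finite bound on the size of pairwise orthogonal sets in $L$; (b) every chain in $L$ is finite; (c) every block of $L$ is finite; (d) $L$ is atomic and of finite height; (e) the set of atoms in $L$ is open.
   Context: An orthoalgebra is a structure $(L,\oplus,0,1)$ consisting of a set $L$, a partially-defined binary operation $\oplus$ on $L$, and two distinguished elements $0,1\in L$. The operation is commutative (if $a\oplus b$ is defined then so is $b\oplus a$ and they are equal) and associative in the strong sense (writing $a\perp b$, ''$a$ and $b$ are orthogonal'', when $a\oplus b$ is defined: if $a\perp b$ and $(a\oplus b)\perp c$, then $b\perp c$, $a\perp (b\oplus c)$ and $(a\oplus b)\oplus c=a\oplus(b\oplus c)$). Moreover, for all $a\in L$: (a) $a\oplus 0=0\oplus a=a$; (b) there is a unique $a'\in L$ with $a\oplus a'=1$; (c) $a\oplus a$ exists only if $a=0$. An orthoalgebra is partially ordered by $a\le b$ iff there is $c\in L$ with $b=a\oplus c$, and $'$ is an orthocomplementation for this order. The orthoalgebra is Boolean if the orthoposet $(L,\le,{}',0,1)$ is a Boolean lattice. A topological orthoalgebra is an orthoalgebra equipped with a topology such that the relation $\perp\subseteq L\times L$ is closed and the mappings $\oplus:\perp\to L$ and ${}':L\to L$ are continuous. A set is pairwise orthogonal if any two distinct elements of it are orthogonal. Chains, atoms and height refer to the order $\le$: an atom is a minimal non-zero element; $L$ is atomic if every non-zero element lies above an atom; $L$ has finite height if there is a finite bound on the lengths of chains. A block of $L$ is a maximal Boolean sub-orthoalgebra of $L$.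 *)

(* Defs.v *)
From HB Require Import structures.
From mathcomp Require Import all_boot all_order.
From mathcomp Require Import all_classical.
From mathcomp Require Import topology.

Set Implicit Arguments.
Unset Strict Implicit.
Unset Printing Implicit Defensive.

Local Open Scope classical_set_scope.
Local Open Scope card_scope.

(* The partial operation is option-valued: [oplus a b = Some s] means that
   a (+) b is defined and equal to s, and [None] that it is undefined.
   [oorth a] is a'; [oplus_orth] and [oorth_uniq] together say that it is the
   unique element whose sum with a is 1.  The elements 0 and 1 are not required
   to be different. *)
HB.mixin Record isOrthoalgebra L := {
  oplus : L -> L -> option L;
  ozero : L;
  oone : L;
  oorth : L -> L;
  oplusC : forall a b, oplus a b = oplus b a;
  oplusA : forall a b c s t, oplus a b = Some s -> oplus s c = Some t ->
    exists2 u, oplus b c = Some u & oplus a u = Some t;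
  oplus0 : forall a, oplus a ozero = Some a;
  oplus_orth : forall a, oplus a (oorth a) = Some oone;
  oorth_uniq : forall a b, oplus a b = Some oone -> b = oorth a;
  oplus_self : forall a s, oplus a a = Some s -> a = ozero
}.

#[short(type="orthoalgebraType")]
HB.structure Definition Orthoalgebra := { L of isOrthoalgebra L }.

Arguments ozero {s}.
Arguments oone {s}.

Definition operp (L : orthoalgebraType) (a b : L) : Prop :=
  exists s, oplus a b = Some s.

Definition ole (L : orthoalgebraType) (a b : L) : Prop :=
  exists c, oplus a c = Some b.

Definition perp_set (L : orthoalgebraType) : set (L * L) :=
  [set p | operp p.1 p.2].

(* [oplus] as a total function on pairs; its values outside [perp_set] are
   irrelevant, since continuity is only required for the subspace topology. *)
Definition oplus_pair (L : orthoalgebraType) (p : L * L) : L :=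
  odflt ozero (oplus p.1 p.2).

HB.mixin Record Orthoalgebra_isTopological L
    of Orthoalgebra L & Topological L := {
  perp_closed : closed (@perp_set L);
  oplus_continuous : {within @perp_set L, continuous (@oplus_pair L)};
  oorth_continuous : continuous (oorth : L -> L)
}.

#[short(type="topOrthoalgebraType")]
HB.structure Definition TopOrthoalgebra :=
  { L of Orthoalgebra L & Topological L & Orthoalgebra_isTopological L }.

Section OrthoalgebraNotions.
Variable L : orthoalgebraType.
Implicit Types (a b : L) (A C M N : set L).

Definition pairwise_orthogonal A : Prop :=
  forall a b, A a -> A b -> a <> b -> operp a b.

Definition is_chain C : Prop := total_on C (@ole L).

Definition is_atom a : Prop :=
  a <> ozero /\ forall b, b <> ozero -> ole b a -> b = a.

Definition is_atomic : Prop :=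
  forall a, a <> ozero -> exists2 b, is_atom b & ole b a.

Definition has_finite_height : Prop :=
  exists n : nat, forall C, is_chain C -> C #<= `I_n.

Definition is_suborthoalgebra M : Prop :=
  [/\ M ozero, M oone, (forall a, M a -> M (oorth a)) &
      forall a b s, M a -> M b -> oplus a b = Some s -> M s].

(* The order of M as an orthoalgebra in its own right. *)
Definition ole_in M a b : Prop := exists2 c, M c & oplus a c = Some b.

(* (M, <=, ', 0, 1) is a Boolean lattice: it is the copy, along a bijection
   onto M, of a bounded distributive lattice with complements. *)
Definition is_boolean M : Prop :=
  exists (d : Order.disp_t) (B : ctbDistrLatticeType d) (f : B -> L),
    [/\ set_bij [set: B] M f,
        (forall x y : B, ole_in M (f x) (f y) <-> (x <= y)%O),
        (forall x : B, f (~` x)%O = oorth (f x)),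
        f \bot%O = ozero &
        f \top%O = oone].

Definition is_boolean_sub M : Prop := is_suborthoalgebra M /\ is_boolean M.

Definition is_block M : Prop :=
  is_boolean_sub M /\ forall N, is_boolean_sub N -> M `<=` N -> N = M.

End OrthoalgebraNotions.

(* Main.v *)
(** Since 0 is the only self-orthogonal element, [(a, a)] lies outside the closed
    relation [perp] for every [a <> 0]; as 0 is isolated, every point has an open
    neighbourhood in which distinct elements are never orthogonal.  A finite
    subcover then bounds the size of pairwise orthogonal sets.  Counting
    orthogonal non-zero elements below [a] gives a bounded, strictly increasing
    rank function, whence finite height, atomicity, and the finiteness of Boolean
    blocks (split the interval below [x] along some [y < x]).
    The order is closed, because [a <= b] iff [a] is orthogonal to [b'], so [L]
    is Hausdorff; the non-zero non-atoms are the image under [oplus] of the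
    compact set of orthogonal pairs of non-zero elements, hence a closed set. *)
Require Import Defs.
From HB Require Import structures.
From mathcomp Require Import all_boot all_order finmap.
From mathcomp Require Import all_classical.
From mathcomp Require Import topology.

Local Open Scope classical_set_scope.
Local Open Scope card_scope.

Import Order.Theory.

(** * Cancellation and order in an orthoalgebra *)

Lemma operpC (L : orthoalgebraType) (a b : L) : operp a b -> operp b a.
Proof. by move=> [s]; rewrite oplusC => ?; exists s. Qed.

Lemma operp_self (L : orthoalgebraType) (a : L) : operp a a -> a = ozero.
Proof. by move=> [s]; apply: oplus_self. Qed.

Lemma oorthK (L : orthoalgebraType) (a : L) : oorth (oorth a) = a.
Proof. by symmetry; apply: oorth_uniq; rewrite oplusC oplus_orth. Qed.

(** Reassociating [(b (+) a) (+) s' = 1] shows that [b] is the orthocomplement of [a (+) s']; the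
    same holds for [c]. *)
Lemma oplus_inj (L : orthoalgebraType) (a b c s : L) :
  oplus a b = Some s -> oplus a c = Some s -> b = c.
Proof.
move=> ab ac.
have [u au bu] : exists2 u, oplus a (oorth s) = Some u & oplus b u = Some oone.
  by apply: oplusA (oplus_orth s); rewrite oplusC.
have [v av cv] : exists2 v, oplus a (oorth s) = Some v & oplus c v = Some oone.
  by apply: oplusA (oplus_orth s); rewrite oplusC.
have uv : v = u by case: (etrans (esym av) au).
rewrite uv oplusC in cv; rewrite oplusC in bu.
by rewrite (oorth_uniq _ _ bu) (oorth_uniq _ _ cv).
Qed.

(** Writing 1 as [a' (+) a], associativity makes [a] orthogonal to itself. *)
Lemma operp1 (L : orthoalgebraType) (a : L) : operp a oone -> a = ozero.
Proof.
move=> [t]; rewrite oplusC => a1.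
have := oplus_orth a; rewrite oplusC => a'a.
by have [u /oplus_self] := oplusA _ _ _ _ _ a'a a1.
Qed.

Lemma oplus_eq0 (L : orthoalgebraType) (a b : L) :
  oplus a b = Some ozero -> a = ozero.
Proof.
rewrite oplusC => ba; apply: operp1.
have [u au _] := oplusA _ _ _ _ _ ba (etrans (oplusC _ _) (oplus0 oone)).
by exists u.
Qed.

Lemma ole_refl (L : orthoalgebraType) (a : L) : ole a a.
Proof. by exists ozero; apply: oplus0. Qed.

Lemma ole_trans (L : orthoalgebraType) (a b c : L) :
  ole a b -> ole b c -> ole a c.
Proof.
by move=> [d ad] [e be]; have [u _ au] := oplusA _ _ _ _ _ ad be; exists u.
Qed.

Lemma ole_anti (L : orthoalgebraType) (a b : L) : ole a b -> ole b a -> a = b.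
Proof.
move=> [c ac] [d bd]; have [u cd au] := oplusA _ _ _ _ _ ac bd.
rewrite (oplus_inj _ _ _ _ _ au (oplus0 a)) in cd.
by have := oplus0 a; rewrite -(oplus_eq0 _ _ _ cd) ac => -[].
Qed.

Lemma ole_operp (L : orthoalgebraType) (a b c : L) :
  ole a b -> operp b c -> operp a c.
Proof.
move=> [d]; rewrite oplusC => da [t bc].
by have [u au _] := oplusA _ _ _ _ _ da bc; exists u.
Qed.

Lemma oleE (L : orthoalgebraType) (a b : L) : ole a b <-> operp a (oorth b).
Proof.
split=> [ab|[s ab]].
  by apply: ole_operp ab _; exists oone; apply: oplus_orth.
(* The difference of [b] and [a] is [s']: from [b' (+) (a (+) s') = 1] it follows that
   [a (+) s' = b]. *)
rewrite oplusC in ab; have [u au b'u] := oplusA _ _ _ _ _ ab (oplus_orth s).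
by exists (oorth s); rewrite au (oorth_uniq _ _ b'u) oorthK.
Qed.

Lemma non_atomP (L : orthoalgebraType) (a : L) : a <> ozero ->
  ~ is_atom a <->
  exists b c, [/\ b <> ozero, c <> ozero & oplus b c = Some a].
Proof.
move=> a0; split=> [na|[b [c [b0 c0 bc]]] [_ /(_ b b0)]]; last first.
  move=> /(_ (ex_intro _ c bc)) ba; apply: c0.
  by apply: oplus_inj bc _; rewrite ba oplus0.
apply: contrapT => h; apply: na; split=> // b b0 [c bc].
have [c0|c0] := pselect (c = ozero).
  by move: bc; rewrite c0 oplus0 => -[].
by case: h; exists b, c.
Qed.

(** * Consequences of a bound on orthogonal sets *)

Section BoundedOrthogonality.
Variables (L : orthoalgebraType) (n : nat).
Hypothesis orth_bound :
  forall A : set L, pairwise_orthogonal A -> A #<= `I_n.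

(* The rank of [a] is the largest length of a sequence of pairwise orthogonal
   non-zero elements below [a]; passing from [a] to [oplus a c] allows one to
   append [c]. *)
Lemma bounded_rank : exists2 r : L -> nat, (forall a, r a <= n) &
  forall a b, ole a b -> a <> b -> r a < r b.
Proof.
pose P a k := `[< exists d : nat -> L,
  (forall i, i < k -> d i <> ozero /\ ole (d i) a) /\
  (forall i j, i < k -> j < k -> i <> j -> operp (d i) (d j)) >].
have P0 a : exists k, P a k by exists 0; apply/asboolP; exists (fun=> a).
have Pn a k : P a k -> k <= n.
  move=> /asboolP[d [d0 dd]]; rewrite -card_le_II.
  (* A repeated term would be orthogonal to itself, hence 0; so the [k] terms form an orthogonal set
     of size [k]. *)
  have dinj : {in `I_k &, injective d}.
    move=> i j; rewrite !inE/= => ik jk dij; apply: contrapT => ij.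
    have := dd i j ik jk ij; rewrite -dij => /operp_self.
    by case: (d0 i ik).
  rewrite -(card_le_eql (inj_card_eq dinj)); apply: orth_bound.
  move=> _ _ [i ik <-] [j jk <-] ij; apply: dd => //.
  by apply: contra_not ij => ->.
exists (fun a => ex_maxn (P0 a) (Pn a)) => [a|a b [c ac] ab].
  by case: ex_maxnP => k /Pn.
case: ex_maxnP => k /asboolP[d [d0 dd]] _; case: ex_maxnP => m _; apply.
have ac_ac : operp a c by exists b.
apply/asboolP; exists (fun i => if i < k then d i else c); split.
  move=> i ik; case: ifP => [/d0[di0 dia]|_].
    by split => //; apply: ole_trans dia _; exists c.
  split; last by exists a; rewrite oplusC.
  by move=> c0; apply: ab; move: ac; rewrite c0 oplus0 => -[].
move=> i j; rewrite !ltnS => ik jk ij.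
case: ltnP => ik'; case: ltnP => jk'.
- exact: dd.
- by apply: ole_operp ac_ac; case: (d0 i ik').
- by apply/operpC/(ole_operp _ _ _ _ _ ac_ac); case: (d0 j jk').
(* Here both indices equal [k]. *)
- by case: ij; apply/eqP; rewrite eqn_leq (leq_trans ik) ?(leq_trans jk).
Qed.

Lemma chain_card_bound (C : set L) : is_chain C -> C #<= `I_n.+1.
Proof.
move=> Cchain; have [r rn rlt] := bounded_rank.
(* The rank separates the elements of a chain and takes only the [n.+1] values from 0 to [n]. *)
have rinj : {in C &, injective r}.
  move=> a b; rewrite !inE => Ca Cb rab; apply: contrapT => ab.
  have [ab'|ba] := Cchain a b Ca Cb.
    by have := rlt _ _ ab' ab; rewrite rab ltnn.
  by have := rlt _ _ ba (fun e => ab (esym e)); rewrite rab ltnn.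
rewrite -(card_le_eql (inj_card_eq rinj)); apply: subset_card_le.
by move=> _ [a _ <-] /=; rewrite ltnS.
Qed.

(** Induction on the rank: a non-zero non-atom has a proper non-zero summand, of smaller rank. *)
Lemma bounded_orth_atomic : is_atomic L.
Proof.
have [r _ rlt] := bounded_rank.
move=> a; have [m] := ubnP (r a); elim: m a => // m IH a ram a0.
have [|na] := pselect (is_atom a); first by exists a => //; apply: ole_refl.
have [b [c [b0 c0 bc]]] := (non_atomP _ a a0).1 na.
have ba : ole b a by exists c.
have [|x xa xb] := IH b _ b0; last by exists x => //; apply: ole_trans xb ba.
apply: leq_trans (rlt _ _ ba _) ram => ab; apply: c0.
by apply: oplus_inj bc _; rewrite ab oplus0.
Qed.

End BoundedOrthogonality.

Lemma ranked_interval_finite (d : Order.disp_t) (B : cbDistrLatticeType d)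
    (r : B -> nat) (rlt : forall x y : B, (x < y)%O -> r x < r y) (x : B) :
  finite_set [set z : B | (z <= x)%O].
Proof.
have [m] := ubnP (r x); elim: m x => // m IH x rxm.
(* Without such a [y] the interval is just the bottom and [x]. Otherwise each [z] is the join of its
   meet with [y] and its difference by [y], taken from two intervals of smaller rank. *)
have [[y [yx y0 ynx]]|h] :=
    pselect (exists y : B, [/\ (y <= x)%O, y != \bot%O & y != x]); last first.
  apply: (@sub_finite_set _ _ [set \bot%O; x]); last exact: finite_set2.
  move=> z /= zx; have [->|z0] := eqVneq z \bot%O; first by left.
  by have [->|zx'] := eqVneq z x; [right|case: h; exists z].
have small u : (u < x)%O -> finite_set [set z : B | (z <= u)%O].
  by move=> ux; apply: IH; apply: leq_trans (rlt _ _ ux) _.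
have fy := small y _; have fxy := small (x `\` y)%O _.
apply: sub_finite_set (finite_image2 Order.join (fy _) (fxy _)).
- move=> z /= zx; exists (z `&` y)%O; first exact: leIr.
  exists (z `\` y)%O; first exact: leBl.
  exact: joinIB.
- by rewrite lt_neqAle ynx.
- rewrite lt_neqAle leBx andbT.
  (* If removing [y] left [x] unchanged, [y] would be disjoint from [x], although it lies below
     [x]. *)
  apply: contra y0 => /eqP xy.
  have := diffKI x y.
  by rewrite xy (meet_l yx) => ->.
Qed.

Lemma boolean_finite (L : orthoalgebraType) (r : L -> nat) (M : set L) :
  (forall a b, ole a b -> a <> b -> r a < r b) -> is_boolean M -> finite_set M.
Proof.
move=> rlt [d [B [f [[_ finj fsurj] fle _ _ _]]]].
apply: sub_finite_set fsurj _; apply: finite_image.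
suff -> : [set: B] = [set z | (z <= \top)%O].
  apply: (@ranked_interval_finite _ _ (r \o f)) => x y xy /=.
  apply: rlt; first by have [c _ ?] := (fle x y).2 (ltW xy); exists c.
  move=> fxy; have := lt_eqF xy.
  by rewrite (finj x y _ _ fxy) ?inE// eqxx.
by apply/seteqP; split=> z // _ /=; apply: lex1.
Qed.

(** * Topological arguments *)

Lemma ole_closed (L : topOrthoalgebraType) :
  closed [set p : L * L | ole p.1 p.2].
Proof.
rewrite (_ : mkset _ = (fun p : L * L => (p.1, oorth p.2)) @^-1` @perp_set L).
  apply: preimage_closed (@perp_closed L) => p _.
  apply: cvg_pair; first exact: cvg_fst.
  by apply: continuous_comp; [exact: cvg_snd|exact: oorth_continuous].
by apply/seteqP; split=> p /= /oleE.
Qed.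

(** If [p] and [q] cannot be separated, every neighbourhood of [(p, q)] or [(q, p)] meets the
    diagonal, so both pairs lie in the closed order. *)
Lemma topOrthoalgebra_hausdorff (L : topOrthoalgebraType) : hausdorff_space L.
Proof.
move=> p q pq.
apply: ole_anti; apply: (@ole_closed L (_, _)) => U [[A B] /= [pA qB] ABU].
  by have [z [Az Bz]] := pq A B pA qB; exists (z, z); split;
    [exact: ole_refl|exact: ABU].
by have [z [Az Bz]] := pq B A qB pA; exists (z, z); split;
  [exact: ole_refl|exact: ABU].
Qed.

Section CompactIsolatedZero.
Variable L : topOrthoalgebraType.
Hypothesis Lcompact : compact [set: L].
Hypothesis zero_isolated : isolated [set: L] (ozero : L).

Lemma nbhs_zero1 : nbhs (ozero : L) [set ozero].
Proof. by have [_ [V V0]] := zero_isolated; rewrite setIT => <-. Qed.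

Lemma open_zero1 : open [set ozero : L].
Proof. by rewrite openE => _ ->; apply: nbhs_zero1. Qed.

Lemma orth_separated_nbhs (x : L) : exists V : set L,
  [/\ open V, V x & forall a b, V a -> V b -> operp a b -> a = b].
Proof.
have [->|x0] := pselect (x = ozero).
  by exists [set ozero]; split=> [|//|a b -> ->//]; apply: open_zero1.
have : nbhs (x, x) (~` @perp_set L).
  apply: open_nbhs_nbhs; split; first exact/closed_openC/perp_closed.
  by move=> /operp_self.
move=> [[A B] /= [xA xB] AB]; exists (A `&` B)°; split.
- exact: open_interior.
- exact: filterI.
- move=> a b /interior_subset[Aa _] /interior_subset[_ Bb] ab.
  by case: (AB (a, b) (conj Aa Bb)).
Qed.

Lemma orthogonal_card_bound : exists n : nat,
  forall A : set L, pairwise_orthogonal A -> A #<= `I_n.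
Proof.
have [V Vsep] := choice orth_separated_nbhs.
(* Pointing [L] at 0 gives the structure on which [compact_cover] is used. *)
pose pL : ptopologicalType := HB.pack (TopOrthoalgebra.sort L)
  (isPointed.Build (TopOrthoalgebra.sort L) ozero).
have : compact [set: pL] := Lcompact.
rewrite compact_cover => /(_ L setT V)[||D _ DV].
- by move=> x _; case: (Vsep x).
- by move=> x _; exists x => //; case: (Vsep x).
have [n Dn] := (finite_set_leP _).1 (finite_fset D).
exists n => A Aorth; apply: card_le_trans Dn.
(* [g] picks a member of the subcover containing [a]; distinct orthogonal elements cannot share
   one. *)
have [g gP] : {g : L -> L & forall a, g a \in D /\ V (g a) a}.
  have DVx a : exists x, x \in D /\ V x a.
    by have [x xD Vxa] := DV a I; exists x.
  by have [g gP] := choice DVx; exists g.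
have ginj : {in A &, injective g}.
  move=> a b; rewrite !inE => Aa Ab gab; apply: contrapT => ab.
  have [_ _ Vg] := Vsep (g a).
  apply: ab (Vg _ _ (gP a).2 _ (Aorth _ _ Aa Ab ab)).
  by rewrite gab; case: (gP b).
rewrite -(card_le_eql (inj_card_eq ginj)); apply: subset_card_le.
by move=> _ [a _ <-]; case: (gP a).
Qed.

Lemma open_atoms : open [set a : L | is_atom a].
Proof.
pose NZ := ~` [set ozero : L].
have cNZ : compact NZ.
  apply: subclosed_compact Lcompact _ => //.
  exact/open_closedC/open_zero1.
pose K := NZ `*` NZ `&` @perp_set L.
have cK : compact (@oplus_pair L @` K).
  apply: continuous_compact.
    by apply: continuous_subspaceW (@oplus_continuous L); apply: subIsetr.
  by apply: compact_closedI (@perp_closed L); apply: compact_setX.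
have closedK := compact_closed (@topOrthoalgebra_hausdorff L) cK.
(* Atoms are the non-zero elements that are not sums of two non-zero ones. *)
rewrite (_ : mkset _ = NZ `&` ~` (@oplus_pair L @` K)).
  apply: openI; last exact: closed_openC.
  apply: closed_openC.
  exact: compact_closed (@topOrthoalgebra_hausdorff L) (@compact_set1 _ _).
apply/seteqP; split=> [a aat|a [a0 aK]] /=.
  have a0 : a <> ozero by case: aat.
  split=> // -[[b c] [[/= b0 c0] [s bc]]]; rewrite /oplus_pair/= bc/= => sa.
  by apply: (non_atomP _ a a0).2 aat; exists b, c; rewrite bc sa.
apply: contrapT => /(non_atomP _ a a0).1[b [c [b0 c0 bc]]]; apply: aK.
by exists (b, c); [split; [|exists a]|rewrite /oplus_pair/= bc].
Qed.

End CompactIsolatedZero.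

Theorem proposition2p11 (L : topOrthoalgebraType)
  (Lcompact : compact [set: L])
  (zero_isolated : isolated [set: L] (ozero : L)) :
  [/\ (exists n : nat,
         forall A : set L, pairwise_orthogonal A -> A #<= `I_n),
      (forall C : set L, is_chain C -> finite_set C),
      (forall M : set L, is_block M -> finite_set M),
      is_atomic L /\ has_finite_height L &
      open [set a : L | is_atom a]].
Proof.
have [n nP] := orthogonal_card_bound _ Lcompact zero_isolated.
split.
- by exists n.
- by move=> C /(chain_card_bound _ _ nP) ?; apply/finite_set_leP; exists n.+1.
- move=> M [[_ Mbool] _]; have [r _ rlt] := bounded_rank _ _ nP.
  exact: boolean_finite rlt Mbool.
- split; first exact: bounded_orth_atomic nP.
  by exists n.+1 => C; apply: chain_card_bound.
- exact: open_atoms.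
Qed.
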